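(* Let $0<\alpha<1$, let $N(t)=N_1(\Lambda(t))$, $t\ge 0$, be the non-homogeneous Poisson process with intensity function $\lambda$, and let $Y_\alpha$ be the inverse stable subordinator, independent of $N_1$. Then, for $t\ge 0$, by the law of total variance, $$\mathrm{Var}[N(Y_\alpha(t))]=\mathbb{E}\big[\mathrm{Var}[N(Y_\alpha(t))\mid Y_\alpha(t)]\big]+\mathrm{Var}\big[\mathbb{E}[N(Y_\alpha(t))\mid Y_\alpha(t)]\big]=\mathbb{E}[\Lambda(Y_\alpha(t))]+\mathrm{Var}[\Lambda(Y_\alpha(t))].$$
   Context: The intensity is a function $\lambda:[0,\infty)\to[0,\infty)$, and $\Lambda(t)=\int_0^t\lambda(u)\,\mathrm{d}u$ is the cumulative rate function. $N_1=\{N_1(t),t\ge 0\}$ is a homogeneous Poisson process with intensity $1$, independent of $Y_\alpha$. $L_\alpha=\{L_\alpha(t),t\ge 0\}$ is the $\alpha$-stable subordinator with $\mathbb{E}[\exp(-sL_\alpha(t))]=\exp(-ts^\alpha)$, $s\ge 0$, and its inverse is $Y_\alpha(t)=\inf\{u\ge 0: L_\alpha(u)>t\}$. *)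

(* Defs.v *)
From HB Require Import structures.
From mathcomp Require Import all_boot all_order all_algebra.
From mathcomp Require Import all_classical all_reals all_analysis.
Import Order.TTheory GRing.Theory Num.Theory.
Import numFieldNormedType.Exports.

Set Implicit Arguments.
Unset Strict Implicit.
Unset Printing Implicit Defensive.

Local Open Scope classical_set_scope.
Local Open Scope ring_scope.

(* Time-dependent objects are indexed by all of [R], but only their values at
   times [t >= 0] are ever constrained or used. *)

Definition sigma_rv d' (T : Type) (S : measurableType d') (W : T -> S) :
    set (set T) :=
  preimage_set_system setT W measurable.

Definition sigma_process d' (T : Type) (S : measurableType d') (R : realType)
    (X : R -> T -> S) : set (set T) :=
  <<s \bigcup_(t in [set t : R | 0 <= t]) sigma_rv (X t) >>.

Definition independent_processes d d1 d2 (T : measurableType d)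
    (S1 : measurableType d1) (S2 : measurableType d2) (R : realType)
    (P : probability T R) (X : R -> T -> S1) (Y : R -> T -> S2) : Prop :=
  forall A B, sigma_process X A -> sigma_process Y B ->
    P (A `&` B) = (P A * P B)%E.

(* Taking some of the [B i] equal to [setT] gives the product rule for
   subfamilies of increments. *)
Definition independent_increments d (T : measurableType d) (R : realType)
    (P : probability T R) (X : R -> T -> R) : Prop :=
  forall (n : nat) (t : nat -> R) (B : nat -> set R),
    0 <= t 0%N -> (forall i, t i <= t i.+1) -> (forall i, measurable (B i)) ->
    P [set w | forall i, (i < n)%N -> B i (X (t i.+1) w - X (t i) w)] =
    (\prod_(i < n) P [set w | B i (X (t i.+1) w - X (t i) w)%R])%E.

(* Counting process with independent increments, the increment over [s, t]
   being Poisson distributed with parameter [rate * (t - s)].  The paths are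
   regular for every outcome, which makes the process jointly measurable.  The
   restriction to [s < t] avoids [poisson_pmf 0], which is not the mass function
   of the point mass at 0. *)
Definition poisson_process d (T : measurableType d) (R : realType)
    (P : probability T R) (rate : R) (N : R -> {RV P >-> nat}) : Prop :=
  [/\ {ae P, forall w, N 0 w = 0%N},
      forall w s t, 0 <= s -> s <= t -> (N s w <= N t w)%N,
      forall w t, 0 <= t -> \forall s \near t^'+, N s w = N t w,
      independent_increments P (fun t w => (N t w)%:R)
    & forall (s t : R) (k : nat), 0 <= s -> s < t ->
        P [set w | N t w = (N s w + k)%N] =
        (poisson_pmf (rate * (t - s)) k)%:E].
Arguments poisson_process {d T R} P rate N.

(* A Levy process with nondecreasing paths; left limits exist by monotonicity. *)
Definition subordinator d (T : measurableType d) (R : realType)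
    (P : probability T R) (L : R -> {RV P >-> R}) : Prop :=
  [/\ {ae P, forall w, L 0 w = 0},
      forall w s t, 0 <= s -> s <= t -> L s w <= L t w,
      forall w t, 0 <= t -> L s w @[s --> t^'+] --> L t w,
      independent_increments P (fun t w => L t w)
    & forall (s t : R) (B : set R), 0 <= s -> s <= t -> measurable B ->
        P [set w | B (L t w - L s w)] = P [set w | B (L (t - s) w)]].
Arguments subordinator {d T R} P L.

Definition stable_subordinator d (T : measurableType d) (R : realType)
    (P : probability T R) (alpha : R) (L : R -> {RV P >-> R}) : Prop :=
  subordinator P L /\
  forall t s : R, 0 <= t -> 0 <= s ->
    'E_P[fun w => expR (- s * L t w)]%E = (expR (- t * s `^ alpha))%:E.
Arguments stable_subordinator {d T R} P alpha L.

(* [inf] is real-valued with [inf set0 = 0]; for a stable subordinator the set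
   below is almost surely nonempty, so this convention is immaterial. *)
Definition inverse_subordinator d (T : measurableType d) (R : realType)
    (P : probability T R) (L : R -> {RV P >-> R}) (t : R) (w : T) : R :=
  inf [set u : R | 0 <= u /\ t < L u w].
Arguments inverse_subordinator {d T R P} L t w.

Definition intensity (R : realType) (lambda : R -> R) : Prop :=
  (forall u, 0 <= u -> 0 <= lambda u) /\
  (forall t, 0 <= t ->
     (@lebesgue_measure R).-integrable `[0, t] (EFin \o lambda)).

Definition cumulative_rate (R : realType) (lambda : R -> R) (t : R) : R :=
  \int[@lebesgue_measure R]_(u in `[0, t]) lambda u.

Definition nonhomogeneous_poisson d (T : measurableType d) (R : realType)
    (P : probability T R) (lambda : R -> R) (N1 : R -> {RV P >-> nat})
    (t : R) (w : T) : nat :=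
  N1 (cumulative_rate lambda t) w.
Arguments nonhomogeneous_poisson {d T R P} lambda N1 t w.

(* [Z] is a version of E[X | W].  Meaningful for [X] nonnegative (possibly of
   infinite mean) or integrable. *)
Definition is_cond_expectation d d' (T : measurableType d)
    (S : measurableType d') (R : realType) (P : probability T R)
    (X : T -> R) (W : T -> S) (Z : T -> R) : Prop :=
  sigma_rv Z `<=` sigma_rv W /\
  forall A, sigma_rv W A ->
    (\int[P]_(w in A) (Z w)%:E = \int[P]_(w in A) (X w)%:E)%E.

(* [V] is a version of Var[X | W] = E[(X - E[X | W])^2 | W]. *)
Definition is_cond_variance d d' (T : measurableType d)
    (S : measurableType d') (R : realType) (P : probability T R)
    (X : T -> R) (W : T -> S) (V : T -> R) : Prop :=
  exists2 M, is_cond_expectation P X W M &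
    is_cond_expectation P (fun w => (X w - M w) ^+ 2) W V.

(* Main.v *)
Require Import Defs.
From HB Require Import structures.
From mathcomp Require Import all_boot all_order all_algebra.
From mathcomp Require Import all_classical all_reals all_analysis.
From mathcomp Require Import measurable_realfun ring.
Import Order.TTheory GRing.Theory Num.Theory.
Import numFieldNormedType.Exports.

(** Write [r] for the cumulative rate, [W] for the inverse subordinator at the
    given time and [X w = N (r (W w)) w].  Conditionally on [W] the count [X] is
    Poisson with parameter [r W], whose mean and variance are both [r W]; so
    [r \o W] is a version of the conditional mean and of the conditional
    variance, and the two equalities are total variance for this pair.

    Conditioning on [W] is made precise without disintegration.  The count is
    a jointly measurable function of the outcome, seen through the sigma-algebra
    of the Poisson process only, and of [W] ([measurable_counting_process], from
    monotone right-continuous paths).  Independence says that the law of the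
    pair (outcome, [W]) on that product space is a product measure, so Tonelli
    integrates the outcome first with [W] fixed ([independent_fubini],
    [integral_mixed_poisson]).

    These moments may be infinite, but their integrands are nonnegative.  Rather than
    subtract second moments, the proof uses
    [E (K - c)^2 = r + (r - c)^2] for [K] Poisson of parameter [r] and any
    constant [c >= 0] ([poisson_square_deviation]).  With [c] depending on [W]
    and equal to [r W] it gives the conditional variance; with [c] the mean
    of [X], it gives
    [Var X = E (r W) + Var (r W)] ([variance_mixed_poisson]).  The variance of a
    variable of infinite mean is centred at [fine +oo = 0], so the same
    computation covers that case.

    Finally two versions of a conditional expectation agree almost surely
    ([cond_expectation_unique]), so arbitrary versions may be replaced by
    [r \o W]. *)

Local Open Scope classical_set_scope.
Local Open Scope ring_scope.
Local Open Scope ereal_scope.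

(** * Independence and Tonelli *)

Section independence.
Context d d' (T : measurableType d) (S : measurableType d') (R : realType).
Variables (P : probability T R) (G : set (set T)) (W : T -> S).
Hypothesis Gmeas : G `<=` measurable.
Hypothesis mW : measurable_fun setT W.

Lemma g_sigma_algebra_measurable A : <<s G >> A -> measurable A.
Proof.
move=> GA; apply: (GA measurable); split => //.
split=> //; first by move=> B mB; exact: measurableD.
by move=> F mF; exact: bigcup_measurable.
Qed.

(** The identity, with the sigma-algebra of its codomain reduced to the one
    generated by [G]: the whole outcome becomes a random element that carries
    only the information of [G]. *)
Let id_sub : T -> g_sigma_algebraType G := id.

Lemma measurable_id_sub : measurable_fun setT id_sub.
Proof. by move=> _ A mA; rewrite setTI; exact: g_sigma_algebra_measurable. Qed.

Lemma measurable_graph :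
  measurable_fun setT (fun w => (id_sub w, W w)).
Proof. exact: measurable_fun_pair measurable_id_sub mW. Qed.

Hypothesis indep : forall A B, <<s G >> A -> measurable B ->
  P (A `&` W @^-1` B) = P A * P (W @^-1` B).

(** Independence makes the law of [(id_sub, W)] the product of the two marginal
    laws, first on rectangles and hence everywhere. *)
Lemma independent_fubini (F : g_sigma_algebraType G * S -> \bar R) :
  measurable_fun setT F -> (forall z, 0 <= F z) ->
  \int[P]_w F (id_sub w, W w) = \int[P]_w \int[P]_v F (id_sub v, W w).
Proof.
move=> mF F0.
(* The three maps are packaged as random variables, so that their laws are
   probability measures. *)
pose iM := isMeasurableFun.Build _ _ _ _ _ measurable_id_sub.
pose Xi : {mfun _ >-> _} := HB.pack id_sub iM.
pose wM := isMeasurableFun.Build _ _ _ _ _ mW.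
pose XW : {mfun _ >-> _} := HB.pack W wM.
pose gM := isMeasurableFun.Build _ _ _ _ _ measurable_graph.
pose Xg : {mfun _ >-> _} := HB.pack (fun w => (id_sub w, W w)) gM.
transitivity (\int[distribution P Xg]_z F z).
  by rewrite ge0_integral_distribution.
transitivity (\int[distribution P Xi \x distribution P XW]_z F z).
  apply: eq_measure_integral => A mA _; apply/esym.
  apply: product_measure_unique => //.
rewrite fubini_tonelli2// ge0_integral_distribution//; last first.
- by move=> y; apply: integral_ge0.
- exact: measurable_fun_fubini_tonelli_G.
apply: eq_integral => w _ /=.
rewrite /fubini_G ge0_integral_distribution//.
exact: (measurableT_comp mF (pair2_measurable _)).
Qed.
End independence.

(** * Joint measurability of a counting process *)

Section counting_process.
Context d d' (T : measurableType d) (S : measurableType d') (R : realType).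
Variables (N : R -> T -> nat) (G : set (set T)).
Hypothesis sigmaN : forall t, (0 <= t)%R -> sigma_rv (N t) `<=` <<s G >>.
Hypothesis N_nd : forall w s t, (0 <= s)%R -> (s <= t)%R -> (N s w <= N t w)%N.
Hypothesis N_rc : forall w t, (0 <= t)%R -> \forall s \near t^'+, N s w = N t w.

(** An integer-valued right-continuous path is constant just after [t], so the
    uncountable family of times reduces to rational ones. *)
Lemma counting_process_le_rat w (t : R) j : (0 <= t)%R ->
  (N t w <= j)%N <->
  exists q : rat, (t < ratr q)%R /\ (N (ratr q) w <= j)%N.
Proof.
move=> t0; split=> [Nj|[q [tq]]]; last first.
  by apply: leq_trans; apply: N_nd => //; exact: ltW.
have [e /= e0 He] := N_rc w t t0.
have [q /[!in_itv]/= /andP[tq qe]] := rat_in_itvoo (ltr_pwDr e0 (lexx t)).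
exists q; split=> //; rewrite He//= ltr0_norm ?subr_lt0//.
by rewrite opprB ltrBlDl.
Qed.

(** The event that the count is at most [j] is a countable union, over rational
    times [q], of rectangles: the count at [q] is at most [j], and [r y < q]. *)
Lemma measurable_counting_process (r : S -> R) :
  measurable_fun setT r -> (forall y, (0 <= r y)%R) ->
  measurable_fun setT (fun z : g_sigma_algebraType G * S => N (r z.2) z.1).
Proof.
move=> mr r0.
have mle j : measurable
    [set z : g_sigma_algebraType G * S | (N (r z.2) z.1 <= j)%N].
  rewrite (_ : [set _ | _] = \bigcup_(q : rat)
      ([set w | (0 <= ratr q :> R)%R /\ (N (ratr q) w <= j)%N] `*`
        (r @^-1` `]-oo, ratr q[))).
    apply: bigcupT_measurable_rat => q; apply: measurableX.
      have [q0|q0] := boolP (0 <= ratr q :> R)%R.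
        rewrite (_ : [set _ | _] = N (ratr q) @^-1` [set k | (k <= j)%N]).
          apply: (sigmaN _ q0); exists [set k | (k <= j)%N] => //.
          by rewrite setTI.
        by apply/seteqP; split=> [w []|w].
      rewrite (_ : [set _ | _] = set0)//.
      by apply/seteqP; split=> [w []|w]//; rewrite (negbTE q0).
    by rewrite -[X in measurable X]setTI; exact: mr.
  apply/seteqP; split=> [[w y]/=|[w y] [q _] [/= [q0 Nq]]].
    move=> /(counting_process_le_rat _ _ _ (r0 y)) [q [rq Nq]].
    exists q => //; split=> /=; last by rewrite in_itv.
    by split=> //; rewrite (le_trans (r0 y)) ?ltW.
  rewrite in_itv/= => rq.
  by apply/(counting_process_le_rat _ _ _ (r0 y)); exists q.
(* Level sets are differences of consecutive sublevel sets; the guard [0 < j]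
   makes the subtracted set empty at [j = 0], where [j.-1 = j]. *)
move=> _ B _; rewrite setTI.
rewrite (_ : _ @^-1` B = \bigcup_(j in B)
    ([set z : g_sigma_algebraType G * S | (N (r z.2) z.1 <= j)%N] `\`
     [set z | (0 < j)%N /\ (N (r z.2) z.1 <= j.-1)%N])).
  apply: bigcup_measurable => -[|j] _; apply: measurableD => //=.
    rewrite (_ : [set _ | _] = set0)//.
    by apply/seteqP; split=> // z [].
  rewrite (_ : [set _ | _] = [set z | (N (r z.2) z.1 <= j)%N])//.
  by apply/seteqP; split=> // z [].
apply/seteqP; split=> [z Bz|z [j Bj] [/= Nj nNj]].
  exists (N (r z.2) z.1) => //; split=> //= -[].
  by case: (N _ _) => // k _ /=; rewrite ltnn.
rewrite (_ : N (r z.2) z.1 = j)//; apply/eqP; rewrite eqn_leq Nj/=.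
by case: j {Bj Nj} nNj => // j nNj; rewrite ltnNge; apply/negP => h; exact: nNj.
Qed.

End counting_process.

(** * Moments of the Poisson distribution *)

Section poisson_moments.
Context d (T : measurableType d) (R : realType) (P : probability T R).
Variables (X : T -> nat) (r : R).
Hypothesis mX : measurable_fun setT X.
(* Unlike [poisson_pmf], this formula gives the point mass at 0 when [r = 0]. *)
Hypothesis pmfX : forall k,
  P [set w | X w = k] = (r ^+ k * k`!%:R^-1 * expR (- r))%:E.

Let p k := P [set w | X w = k].

Lemma integral_nat_rv (f : nat -> R) : (forall k, (0 <= f k)%R) ->
  \int[P]_w (f (X w))%:E = \sum_(k <oo) (f k)%:E * p k.
Proof.
move=> f0.
have mXk k : measurable [set w | X w = k].
  rewrite -[X in measurable X]setTI.
  exact: (mX measurableT [set k]).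
have -> : [set: T] = \bigcup_k [set w | X w = k].
  by apply/seteqP; split=> // w _; exists (X w).
rewrite ge0_integral_bigcup//=.
- apply: eq_eseriesr => k _; rewrite -integral_cst//.
  by apply: eq_integral => w; rewrite inE /= => ->.
- apply/measurable_EFinP; apply: measurable_funTS.
  have mf : measurable_fun setT f by [].
  exact: measurableT_comp mf mX.
- by move=> w _; rewrite lee_fin.
- by move=> i j _ _ [w [/= <- <-]].
Qed.

Let pS k : (k.+1%:R)%:E * p k.+1 = r%:E * p k.
Proof.
rewrite /p !pmfX -!EFinM; congr EFin.
have k0 : (k.+1%:R != 0 :> R)%R by rewrite pnatr_eq0.
have kf0 : (k`!%:R != 0 :> R)%R by rewrite pnatr_eq0 -lt0n fact_gt0.
rewrite factS natrM exprS; move: k0 kf0.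
by move: (k.+1%:R : R)%R (k`!%:R : R)%R => a b a0 b0; field; rewrite a0 b0.
Qed.

Let p_sum : \sum_(k <oo) p k = 1.
Proof.
have := integral_nat_rv (fun=> 1%R) (fun=> ler01).
rewrite integral_cst//= probability_setT mule1 => ->.
by apply: eq_eseriesr => k _; rewrite mul1e.
Qed.

(** Each factor [k] in the summand lowers the index of the mass by one and
    brings out a factor [r], so factorial moments reduce to the total mass 1. *)
Let shift_sum (g : nat -> R) : (forall k, (0 <= g k)%R) ->
  \sum_(k <oo) (g k * k%:R)%:E * p k = r%:E * \sum_(k <oo) (g k.+1)%:E * p k.
Proof.
move=> g0.
have gp0 k : 0 <= (g k * k%:R)%:E * p k.
  by rewrite mule_ge0 ?lee_fin ?mulr_ge0.
rewrite nneseries_recl// mulr0 mul0e add0e.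
rewrite -(nneseries_addn 1) -?nneseriesZl//; last first.
  by move=> k _; rewrite mule_ge0 ?lee_fin.
apply: eq_eseriesr => k _.
by rewrite addn1 EFinM -muleA pS muleCA.
Qed.

Lemma poisson_mean : \int[P]_w (X w)%:R%:E = r%:E.
Proof.
rewrite integral_nat_rv//.
under eq_eseriesr do rewrite -[_%:R%R]mul1r.
rewrite (shift_sum (fun=> 1%R))//.
under eq_eseriesr do rewrite mul1e.
by rewrite p_sum mule1.
Qed.

Let poisson_factorial_moment :
  \int[P]_w ((X w)%:R * (X w).-1%:R)%:E = (r ^+ 2)%:E.
Proof.
rewrite (integral_nat_rv (fun k => k%:R * k.-1%:R)%R); last first.
  by move=> k; rewrite mulr_ge0.
under eq_eseriesr do rewrite (mulrC _%:R%R).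
rewrite (shift_sum (fun k => k.-1%:R)%R)//=.
have := integral_nat_rv (fun k => k%:R)%R (ler0n R).
by rewrite poisson_mean => <-; rewrite -EFinM -expr2.
Qed.

(** For [c >= 0] both sides of
    [(k - c)^2 + 2 c k = k (k - 1) + (k + c^2)] are sums of nonnegative terms,
    so they can be integrated termwise without integrability conditions. *)
Lemma poisson_square_deviation c : (0 <= c)%R ->
  \int[P]_w (((X w)%:R - c) ^+ 2)%:E = (r + (r - c) ^+ 2)%:E.
Proof.
move=> c0.
have mXR : measurable_fun setT (fun w => (X w)%:R : R).
  have mf : measurable_fun setT (fun k : nat => k%:R : R) by [].
  exact: measurableT_comp mf mX.
have mX1 : measurable_fun setT (fun w => (X w).-1%:R : R).
  have mf : measurable_fun setT (fun k : nat => k.-1%:R : R) by [].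
  exact: measurableT_comp mf mX.
have : \int[P]_w ((((X w)%:R - c) ^+ 2)%:E + (2 * c)%:E * (X w)%:R%:E) =
  \int[P]_w (((X w)%:R * (X w).-1%:R)%:E + ((X w)%:R%:E + (c ^+ 2)%:E)).
  apply: eq_integral => w _; rewrite -EFinM -!EFinD; congr EFin.
  case: (X w) => [|k] /=; first by ring.
  by rewrite -natr1; ring.
have m1 : measurable_fun setT (fun w => (((X w)%:R - c) ^+ 2)%R).
  by apply: measurable_funX; exact: measurable_funB.
rewrite ge0_integralD//; last 4 first.
- by move=> w _; rewrite lee_fin sqr_ge0.
- exact/measurable_EFinP.
- by move=> w _; rewrite -EFinM lee_fin !mulr_ge0.
- by apply: measurable_funeM; exact/measurable_EFinP.
rewrite ge0_integralZl//; last 2 first.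
- exact/measurable_EFinP.
- by rewrite lee_fin mulr_ge0.
rewrite poisson_mean ge0_integralD//; last 3 first.
- by apply/measurable_EFinP; exact: measurable_funM.
- by move=> w _; rewrite -EFinD lee_fin addr_ge0 ?sqr_ge0.
- by apply: emeasurable_funD => //; exact/measurable_EFinP.
rewrite poisson_factorial_moment ge0_integralD//; last 2 first.
- exact/measurable_EFinP.
- by move=> w _; rewrite lee_fin sqr_ge0.
rewrite poisson_mean integral_cst//= probability_setT mule1.
rewrite -EFinM -!EFinD.
(* An infinite deviation would contradict the equation, whose right-hand side
   is finite. *)
move: (\int[P]_w _) => [x| |]//; rewrite -EFinD => -[E]; congr EFin.
by rewrite -[LHS](addrK (2 * c * r)%R) E; ring.
Qed.

End poisson_moments.

(** * The processes at a fixed time *)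

Lemma ae_eq_probability d (T : measurableType d) (R : realType)
    (P : probability T R) (A B : set T) :
  measurable A -> measurable B -> {ae P, forall w, A w <-> B w} -> P A = P B.
Proof.
move=> mA mB AB; rewrite -!expectation_indic//= unlock.
apply: ge0_ae_eq_integral => //.
- exact/measurable_EFinP.
- exact/measurable_EFinP.
- apply: filterS AB => w ABw _; rewrite !indicE; congr ((nat_of_bool _)%:R%:E).
  by apply/idP/idP; rewrite !inE => /ABw.
Qed.

Lemma poisson_process_marginal d (T : measurableType d) (R : realType)
    (P : probability T R) (N : R -> {RV P >-> nat}) (r : R) k :
  poisson_process P 1%R N -> (0 <= r)%R ->
  P [set w | N r w = k] = (r ^+ k * k`!%:R^-1 * expR (- r))%:E.
Proof.
move=> [N00 _ _ _ Npmf] r0.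
have mN s j : measurable (N s @^-1` [set j]) by exact: measurable_funPTI.
move: r0; rewrite le_eqVlt => /predU1P[<-|r0].
  rewrite oppr0 expR0 mulr1; case: k => [|k].
    rewrite expr0 mul1r invr1 -(@probability_setT _ _ _ P).
    apply: ae_eq_probability => //; first exact: mN.
    by apply: filterS N00 => w /= ->.
  rewrite expr0n/= mul0r -[RHS](measure0 P).
  apply: ae_eq_probability => //; first exact: mN.
  by apply: filterS N00 => w /= ->.
have := Npmf 0%R r k (lexx 0%R) r0; rewrite /poisson_pmf mul1r subr0 r0 => <-.
apply: ae_eq_probability => //; [exact: mN| |by apply: filterS N00 => w /= ->].
rewrite (_ : [set _ | _] = \bigcup_j
    (N 0%R @^-1` [set j] `&` N r @^-1` [set (j + k)%N])).
  by apply: bigcup_measurable => j _; exact: measurableI.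
apply/seteqP; split=> [w /= E|w [j _] [/= -> ->]]//.
by exists (N 0%R w).
Qed.

(** By monotonicity of the paths, the infimum is below [x > 0] iff some rational
    time below [x] is already in the set, or the set is empty and the infimum is
    0 by convention; emptiness is tested along the integers. *)
Lemma measurable_inverse_subordinator d (T : measurableType d) (R : realType)
    (P : probability T R) (L : R -> {RV P >-> R}) (t : R) :
  (forall w s u, (0 <= s)%R -> (s <= u)%R -> (L s w <= L u w)%R) ->
  measurable_fun setT (inverse_subordinator L t).
Proof.
move=> L_nd.
have mLt u : measurable [set w : T | (t < L u w)%R].
  rewrite (_ : [set _ | _] = L u @^-1` `]t, +oo[).
    exact: measurable_funPTI.
  by apply/seteqP; split=> w /=; rewrite in_itv/= andbT.
apply: (measurability _ (RGenInftyO.measurableE R)).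
move=> _ [_ [x ->] <-]; rewrite setTI.
have Y0 w : (0 <= inverse_subordinator L t w)%R.
  rewrite /inverse_subordinator; have [->|/set0P A0] :=
    eqVneq [set u : R | (0 <= u)%R /\ (t < L u w)%R] set0.
    by rewrite inf0.
  by apply: lb_le_inf => // u [].
have [x0|x0] := leP x 0%R.
  rewrite (_ : _ @^-1` _ = set0)//.
  by apply/seteqP; split=> // w /=; rewrite in_itv/= ltNge (le_trans x0).
pose A (q : rat) :=
  [set w : T | (0 <= (ratr q : R) < x)%R /\ (t < L (ratr q) w)%R].
pose B (n : nat) := [set w : T | (t < L n%:R w)%R].
suff -> : inverse_subordinator L t @^-1` `]-oo, x[ =
    (\bigcup_q A q) `|` ~` (\bigcup_n B n).
  apply: measurableU; last first.
    by apply: measurableC; apply: bigcupT_measurable => n; exact: mLt.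
  apply: bigcupT_measurable_rat => q.
  have [qx|qx] := boolP (0 <= (ratr q : R) < x)%R.
    rewrite (_ : A q = [set w | (t < L (ratr q) w)%R])//.
    by apply/seteqP; split=> w // [].
  rewrite (_ : A q = set0)//.
  by apply/seteqP; split=> w // []; rewrite (negbTE qx).
apply/seteqP; split=> w /=; rewrite in_itv/=.
  move=> Yx; have [[u [u0 tu]]|Lt] :=
    pselect (exists u, (0 <= u)%R /\ (t < L u w)%R).
    left; have [v [v0 tv] vx] := inf_lt (ex_intro _ u (conj u0 tu)) Yx.
    have [q /[!in_itv]/= /andP[vq qx]] := rat_in_itvoo vx.
    exists q => //=; split; first by rewrite qx (le_trans v0) ?ltW.
    by rewrite (lt_le_trans tv)// L_nd// ltW.
  by right=> -[n _ /= tn]; apply: Lt; exists n%:R.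
case=> [[q _ /= [/andP[q0 qx] tq]]|Lt].
  rewrite (le_lt_trans _ qx)//; apply: ge_inf => //.
  by exists 0%R => u [].
rewrite /inverse_subordinator (_ : [set _ | _] = set0) ?inf0//.
apply/seteqP; split=> // u [u0 tu]; apply: Lt.
exists (Num.truncn u).+1 => //; rewrite /B /= (lt_le_trans tu)// L_nd//.
by rewrite ltW// truncnS_gt.
Qed.

Section cumulative_rate.
Context (R : realType) (lambda : R -> R).
Hypothesis hlambda : intensity lambda.

Lemma cumulative_rate_ge0 t : (0 <= cumulative_rate lambda t)%R.
Proof.
rewrite /cumulative_rate; apply: Rintegral_ge0 => u /=.
by rewrite in_itv/= => /andP[u0 _]; exact: hlambda.1.
Qed.

Lemma cumulative_rate_nondecreasing :
  nondecreasing_fun (cumulative_rate lambda).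
Proof.
move=> s t st; have [s0|s0] := ltP s 0%R.
  rewrite {1}/cumulative_rate set_itv_ge -?leNgt// Rintegral_set0.
  exact: cumulative_rate_ge0.
have [lam0 lamI] := hlambda; have t0 := le_trans s0 st.
apply: fine_le; [exact: integrable_fin_num (lamI _ s0)|
                exact: integrable_fin_num (lamI _ t0)|].
apply: ge0_subset_integral => //.
- exact: measurable_int (lamI _ t0).
- by move=> u /=; rewrite in_itv/= => /andP[u0 _]; rewrite lee_fin lam0.
- by apply: subset_itvl; rewrite bnd_simp.
Qed.

Lemma measurable_cumulative_rate : measurable_fun setT (cumulative_rate lambda).
Proof. exact: nondecreasing_measurable cumulative_rate_nondecreasing. Qed.

End cumulative_rate.

(** * Versions of a conditional expectation *)

Section uniqueness.
Context d d' (T : measurableType d) (S : measurableType d') (R : realType).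
Variables (P : probability T R) (W : T -> S).
Hypothesis mW : measurable_fun setT W.

Lemma sigma_rv_measurable : sigma_rv W `<=` measurable.
Proof. by move=> _ [B mB <-]; exact: mW. Qed.

Lemma sub_sigma_rv_measurable (Z : T -> R) :
  sigma_rv Z `<=` sigma_rv W -> measurable_fun setT Z.
Proof.
by move=> ZW _ B mB; apply: sigma_rv_measurable; apply: ZW; exists B.
Qed.

(** Versions may fail to be integrable, so their integrals are compared on the
    events [- n <= Z < Z' <= n], which belong to the conditioning sigma-algebra
    and on which both versions are bounded. *)
Lemma cond_expectation_nlt (Z Z' : T -> R) :
  sigma_rv Z `<=` sigma_rv W -> sigma_rv Z' `<=` sigma_rv W ->
  (forall A, sigma_rv W A ->
    \int[P]_(w in A) (Z w)%:E = \int[P]_(w in A) (Z' w)%:E) ->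
  P.-negligible [set w | (Z w < Z' w)%R].
Proof.
move=> ZW Z'W ZZ'.
have mZ := sub_sigma_rv_measurable Z ZW.
have mZ' := sub_sigma_rv_measurable Z' Z'W.
have sigW : sigma_algebra setT (sigma_rv W).
  exact/sigma_algebra_preimage/sigma_algebra_measurable.
pose E (n : nat) :=
  [set w : T | (- n%:R <= Z w)%R] `&` [set w | (Z' w <= n%:R)%R] `&`
  [set w | (Z w < Z' w)%R].
have WE n : sigma_rv W (E n).
  rewrite -(sigma_algebra_id sigW).
  have sZ : measurable_fun setT (Z : g_sigma_algebraType (sigma_rv W) -> R).
    by move=> _ B mB; apply: sub_sigma_algebra; apply: ZW; exists B.
  have sZ' : measurable_fun setT (Z' : g_sigma_algebraType (sigma_rv W) -> R).
    by move=> _ B mB; apply: sub_sigma_algebra; apply: Z'W; exists B.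
  have sB : measurable_fun setT
      ((fun w => Z' w - Z w)%R : g_sigma_algebraType (sigma_rv W) -> R).
    exact: measurable_funB.
  have h1 := sZ measurableT _ (measurable_itv `[(- n%:R)%R, +oo[).
  have h2 := sZ' measurableT _ (measurable_itv `]-oo, n%:R%R]).
  have h3 := sB measurableT _ (measurable_itv `]0%R, +oo[).
  suff -> : E n = Z @^-1` `[(- n%:R)%R, +oo[ `&` Z' @^-1` `]-oo, n%:R%R] `&`
      (fun w => Z' w - Z w)%R @^-1` `]0%R, +oo[.
    rewrite !setTI in h1 h2 h3.
    exact: measurableI (measurableI _ _ h1 h2) h3.
  by apply/seteqP; split=> w /=; rewrite !in_itv/= !andbT subr_gt0.
apply: (@negligibleS _ _ _ _ (\bigcup_n E n)).
  move=> w /= ZZ'w.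
  exists (Num.truncn (`|Z w| + `|Z' w|)).+1 => //; split=> //=; split=> /=.
    rewrite lerNl (le_trans _ (ltW (truncnS_gt _)))//.
    by rewrite (le_trans (ler_norm _))// normrN lerDl.
  rewrite (le_trans _ (ltW (truncnS_gt _)))//.
  by rewrite (le_trans (ler_norm _))// lerDr.
apply: negligible_bigcup => n.
have mE := sigma_rv_measurable _ (WE n).
have bnd (f : T -> R) : measurable_fun setT f ->
    (forall w, E n w -> `|f w| <= n%:R)%R -> P.-integrable (E n) (EFin \o f).
  move=> mf fn; apply: measurable_bounded_integrable => //.
  - by rewrite (le_lt_trans (probability_le1 P mE)) ?ltry.
  - exact: measurable_funTS.
  - exists n%:R; split; first exact: num_real.
    by move=> M nM w /= Ew; rewrite (le_trans (fn _ Ew))// ltW.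
have iZ : P.-integrable (E n) (EFin \o Z).
  apply: bnd => // w [[/= nZ Zn] ZZ'w].
  by rewrite ler_norml nZ (le_trans (ltW ZZ'w)).
have iZ' : P.-integrable (E n) (EFin \o Z').
  apply: bnd => // w [[/= nZ Zn] ZZ'w].
  by rewrite ler_norml Zn (le_trans nZ) ?ltW.
have mB : measurable_fun (E n) (fun w => ((Z' w)%:E - (Z w)%:E)).
  apply: emeasurable_funB; first exact: measurable_int iZ'.
  exact: measurable_int iZ.
have : \int[P]_(w in E n) `|(Z' w)%:E - (Z w)%:E| = 0.
  transitivity (\int[P]_(w in E n) ((Z' w)%:E - (Z w)%:E)).
    apply: eq_integral => w; rewrite inE => -[_ /= ZZ'w].
    by rewrite /= ger0_norm// subr_ge0 ltW.
  rewrite integralB_EFin// ZZ'// subee//.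
  exact: integrable_fin_num iZ'.
move=> /(ae_eq_integral_abs _ mE mB); apply: negligibleS => w Ew /= /(_ Ew).
by case: Ew => _ /= ZZ'w; rewrite -EFinB => -[] /eqP; rewrite subr_eq0 gt_eqF.
Qed.

Lemma cond_expectation_unique (X Z Z' : T -> R) :
  is_cond_expectation P X W Z -> is_cond_expectation P X W Z' ->
  {ae P, forall w, Z w = Z' w}.
Proof.
move=> [ZW ZX] [Z'W Z'X].
have lt := cond_expectation_nlt Z Z' ZW Z'W _.
have gt := cond_expectation_nlt Z' Z Z'W ZW _.
apply: negligibleS (negligibleU (lt _) (gt _)) => [w /= /eqP|A WA|A WA].
- by rewrite neq_lt => /orP[]; [left|right].
- by rewrite ZX// Z'X.
- by rewrite ZX// Z'X.
Qed.

End uniqueness.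

(** * A Poisson process at an independent random time *)

Section mixed_poisson.
Context d (T : measurableType d) (R : realType) (P : probability T R).
Context d' (S : measurableType d').
Variables (N : R -> {RV P >-> nat}) (W : T -> S) (r : S -> R).
Hypothesis hN : poisson_process P 1%R N.
Hypothesis mW : measurable_fun setT W.
Hypothesis mr : measurable_fun setT r.
Hypothesis r0 : forall y, (0 <= r y)%R.
Hypothesis indep : forall A B, sigma_process (fun t w => N t w) A ->
  measurable B -> P (A `&` W @^-1` B) = P A * P (W @^-1` B).

Let G := \bigcup_(t in [set t : R | (0 <= t)%R]) sigma_rv (N t).

Let Gmeas : G `<=` measurable.
Proof. by move=> _ [t _ [B mB <-]]; exact: measurable_funP. Qed.

Let mN : measurable_fun setT
  (fun z : g_sigma_algebraType G * S => (N (r z.2) z.1)%:R : R).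
Proof.
have mnat : measurable_fun setT (fun k : nat => k%:R : R) by [].
have [_ Nnd Nrc _ _] := hN.
have sN t : (0 <= t)%R -> sigma_rv (N t) `<=` <<s G >>.
  by move=> t0 A NA; apply: sub_sigma_algebra; exists t.
have h := measurable_counting_process _ _ _ _ _
  (fun t w => N t w) G sN Nnd Nrc r mr r0.
exact: measurableT_comp mnat h.
Qed.

Let X w : R := (N (r (W w)) w)%:R.

Lemma measurable_mixed_poisson : measurable_fun setT X.
Proof. exact: measurableT_comp mN (measurable_graph _ _ _ _ G W Gmeas mW). Qed.

(** Freezing [W]: on an event of [W], a function of [X] and [W] has the same
    integral as its mean [h] over the Poisson process alone.  This is the source
    of all conditional moments below. *)
Lemma integral_mixed_poisson (F : R -> S -> R) (h : S -> R) (B : set S) :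
  measurable B ->
  measurable_fun setT (fun z : R * S => F z.1 z.2) ->
  (forall x y, (0 <= F x y)%R) ->
  (forall y, \int[P]_v (F (N (r y) v)%:R y)%:E = (h y)%:E) ->
  \int[P]_(w in W @^-1` B) (F (X w) (W w))%:E =
  \int[P]_(w in W @^-1` B) (h (W w))%:E.
Proof.
move=> mB mF F0 Fh.
pose F' (z : g_sigma_algebraType G * S) :=
  (F (N (r z.2) z.1)%:R z.2)%:E * (\1_B z.2)%:E.
have mF1 : measurable_fun setT
    (fun z : g_sigma_algebraType G * S => (F (N (r z.2) z.1)%:R z.2)%:E).
  apply/measurable_EFinP.
  exact: (measurableT_comp mF (measurable_fun_pair mN measurable_snd)).
have mF' : measurable_fun setT F'.
  apply: emeasurable_funM => //; apply/measurable_EFinP.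
  exact: measurableT_comp (measurable_indic mB) measurable_snd.
have F'0 z : 0 <= F' z by rewrite mule_ge0 ?lee_fin.
rewrite integral_mkcond [RHS]integral_mkcond !epatch_indic.
have := independent_fubini _ _ _ _ _ P G W Gmeas mW indep F' mF' F'0.
rewrite /F' /= => ->; apply: eq_integral => w _ /=.
rewrite ge0_integralZr//.
- by rewrite Fh.
- apply/measurable_EFinP.
  have mnat : measurable_fun setT (fun k : nat => k%:R : R) by [].
  have mNw := measurableT_comp mnat (measurable_funPT (N (r (W w)))).
  exact: (measurableT_comp mF (measurable_fun_pair mNw (measurable_cst (W w)))).
- by move=> v _; rewrite lee_fin.
Qed.

Let pmfN y k :
  P [set w | N (r y) w = k] = (r y ^+ k * k`!%:R^-1 * expR (- r y))%:E.
Proof. exact: poisson_process_marginal. Qed.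

Let sigma_rv_comp (g : S -> R) : measurable_fun setT g ->
  sigma_rv (g \o W) `<=` sigma_rv W.
Proof.
move=> mg _ [B mB <-]; exists (g @^-1` B); last by rewrite comp_preimage.
by rewrite -[X in measurable X]setTI; exact: mg.
Qed.

Lemma cond_expectation_mixed_poisson : is_cond_expectation P X W (r \o W).
Proof.
split=> [|_ [B mB <-]]; first exact: sigma_rv_comp.
rewrite setTI.
(* The absolute value makes the integrand nonnegative on all of [R]; it has no
   effect on counts. *)
rewrite -(integral_mixed_poisson (fun x _ => `|x|)%R r B)//.
- by apply: eq_integral => w _; rewrite ger0_norm// /X.
- exact: measurableT_comp measurable_fst.
- move=> y; rewrite -(poisson_mean _ _ _ P (N (r y)) (r y) _ (pmfN y))//.
  by apply: eq_integral => w _; rewrite ger0_norm.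
Qed.

Lemma integral_square_deviation (c : S -> R) (B : set S) :
  measurable_fun setT c -> (forall y, (0 <= c y)%R) -> measurable B ->
  \int[P]_(w in W @^-1` B) ((X w - c (W w)) ^+ 2)%:E =
  \int[P]_(w in W @^-1` B) (r (W w) + (r (W w) - c (W w)) ^+ 2)%:E.
Proof.
move=> mc c0 mB.
apply: (integral_mixed_poisson (fun x y => (x - c y) ^+ 2)%R
  (fun y => r y + (r y - c y) ^+ 2)%R) => //.
- apply: measurable_funX; apply: measurable_funB => //.
  exact: measurableT_comp mc measurable_snd.
- by move=> x y; rewrite sqr_ge0.
- move=> y.
  exact: (poisson_square_deviation _ _ _ P (N (r y)) (r y) _ (pmfN y)).
Qed.

(** The version [M] equals [r \o W] almost surely, and around [r W] the square
    deviation [r + (r - c)^2] with [c = r] reduces to [r]. *)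
Lemma cond_variance_mixed_poisson (M : T -> R) :
  is_cond_expectation P X W M ->
  is_cond_expectation P (fun w => (X w - M w) ^+ 2)%R W (r \o W).
Proof.
move=> hM; have [MW _] := hM.
have mX := measurable_mixed_poisson.
have mM := sub_sigma_rv_measurable _ _ _ _ _ W mW M MW.
have Mr := cond_expectation_unique _ _ _ _ _ P W mW X M _ hM
  cond_expectation_mixed_poisson.
have mrW : measurable_fun setT (r \o W) by exact: measurableT_comp.
split=> [|_ [B mB <-]]; first exact: sigma_rv_comp.
rewrite setTI.
have mWB : measurable (W @^-1` B).
  by rewrite -[X in measurable X]setTI; exact: mW.
transitivity (\int[P]_(w in W @^-1` B) ((X w - r (W w)) ^+ 2)%:E).
  rewrite integral_square_deviation//.
  by apply: eq_integral => w _; rewrite subrr expr0n addr0.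
apply: ge0_ae_eq_integral => //.
- apply/measurable_EFinP/measurable_funX; apply: measurable_funTS.
  exact: measurable_funB.
- apply/measurable_EFinP/measurable_funX; apply: measurable_funTS.
  exact: measurable_funB.
- by move=> w _; rewrite lee_fin sqr_ge0.
- by move=> w _; rewrite lee_fin sqr_ge0.
- by apply: filterS Mr => w Mrw _ /=; rewrite Mrw.
Qed.

Lemma expectation_mixed_poisson : 'E_P[X] = 'E_P[r \o W].
Proof.
rewrite expectation.unlock.
have [_ /(_ setT)] := cond_expectation_mixed_poisson.
by move=> -> //; exists setT => //; rewrite setTI.
Qed.

(** [X] and [r \o W] have the same mean, hence are centred at the same constant
    [c >= 0], and [integral_square_deviation] applies to this constant. *)
Lemma variance_mixed_poisson : 'V_P[X] = 'E_P[r \o W] + 'V_P[r \o W].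
Proof.
have mrW : measurable_fun setT (r \o W) by exact: measurableT_comp.
have E0 : 0 <= 'E_P[r \o W] by apply: expectation_ge0 => w /=.
rewrite /variance covariance.unlock expectation_mixed_poisson.
have c0 := fine_ge0 E0; move: (fine _) c0 => c c0.
rewrite expectation.unlock.
transitivity (\int[P]_w (r (W w) + (r (W w) - c) ^+ 2)%:E).
  have := integral_square_deviation (fun=> c) setT.
  rewrite preimage_setT => <- //.
under eq_integral do rewrite EFinD.
rewrite ge0_integralD//.
- by move=> w _; rewrite lee_fin.
- exact/measurable_EFinP.
- by move=> w _; rewrite lee_fin sqr_ge0.
- by apply/measurable_EFinP/measurable_funX; exact: measurable_funB.
Qed.

End mixed_poisson.

(** * The law of total variance *)

Lemma ae_eq_expectation d (T : measurableType d) (R : realType)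
    (P : probability T R) (f g : T -> R) :
  measurable_fun setT f -> measurable_fun setT g ->
  {ae P, forall w, f w = g w} -> 'E_P[f] = 'E_P[g].
Proof.
move=> mf mg fg; rewrite unlock; apply: ae_eq_integral => //.
- exact/measurable_EFinP.
- exact/measurable_EFinP.
- by apply: filterS fg => w fgw _ /=; rewrite fgw.
Qed.

Lemma ae_eq_variance d (T : measurableType d) (R : realType)
    (P : probability T R) (f g : T -> R) :
  measurable_fun setT f -> measurable_fun setT g ->
  {ae P, forall w, f w = g w} -> 'V_P[f] = 'V_P[g].
Proof.
move=> mf mg fg; have E := ae_eq_expectation _ _ _ P f g mf mg fg.
rewrite /variance covariance.unlock E.
apply: ae_eq_expectation.
- by apply: measurable_funM; exact: measurable_funB.
- by apply: measurable_funM; exact: measurable_funB.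
- by apply: filterS fg => w fgw; rewrite -[LHS]/((f w - _) * (f w - _))%R fgw.
Qed.

(** The conditional mean and variance are both represented by [Lambda \o Y], and
    all other versions agree with it almost surely, so both equalities come down
    to [variance_mixed_poisson]. *)
Theorem mainTheorem4 (d : measure_display) (T : measurableType d)
    (R : realType) (P : probability T R)
    (alpha : R) (lambda : R -> R)
    (N1 : R -> {RV P >-> nat}) (L : R -> {RV P >-> R})
    (halpha : (0 < alpha < 1)%R)
    (hlambda : intensity lambda)
    (hN1 : poisson_process P 1%R N1)
    (hL : stable_subordinator P alpha L)
    (hind : independent_processes P (fun t w => N1 t w)
              (inverse_subordinator L))
    (t : R) (ht : (0 <= t)%R) :
  let Lambda := cumulative_rate lambda in
  let N := nonhomogeneous_poisson lambda N1 in
  let Y := inverse_subordinator L t in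
  let X := fun w => (N (Y w) w)%:R : R in
  (exists M, is_cond_expectation P X Y M) /\
  (exists V, is_cond_variance P X Y V) /\
  forall M V : T -> R,
    is_cond_expectation P X Y M -> is_cond_variance P X Y V ->
    'V_P[X] = 'E_P[V] + 'V_P[M] /\
    'E_P[V] + 'V_P[M] = 'E_P[Lambda \o Y] + 'V_P[Lambda \o Y].
Proof.
move=> Lambda N Y X.
have mY : measurable_fun setT Y.
  by apply: measurable_inverse_subordinator; have [[]] := hL.
have mLambda := measurable_cumulative_rate R lambda hlambda.
have Lambda0 := cumulative_rate_ge0 R lambda hlambda.
have indep A B : sigma_process (fun t w => N1 t w) A -> measurable B ->
    P (A `&` Y @^-1` B) = P A * P (Y @^-1` B).
  move=> NA mB; apply: hind => //; apply: sub_sigma_algebra.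
  by exists t => //; exists B => //; rewrite setTI.
have condE : is_cond_expectation P X Y (Lambda \o Y).
  exact: (cond_expectation_mixed_poisson _ _ _ P _ _ N1 Y).
have condV M : is_cond_expectation P X Y M ->
    is_cond_expectation P (fun w => (X w - M w) ^+ 2)%R Y (Lambda \o Y).
  exact: (cond_variance_mixed_poisson _ _ _ P _ _ N1 Y).
split; first by exists (Lambda \o Y).
split; first by exists (Lambda \o Y); exists (Lambda \o Y) => //; exact: condV.
move=> M V hM [M' hM' hV].
have mLY : measurable_fun setT (Lambda \o Y) by exact: measurableT_comp.
have meas Z : sigma_rv Z `<=` sigma_rv Y -> measurable_fun setT (Z : T -> R).
  exact: sub_sigma_rv_measurable.
have -> : 'V_P[M] = 'V_P[Lambda \o Y].
  apply: ae_eq_variance => //; first exact: meas hM.1.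
  exact: cond_expectation_unique mY _ _ _ hM condE.
have -> : 'E_P[V] = 'E_P[Lambda \o Y].
  apply: ae_eq_expectation => //; first exact: meas hV.1.
  exact: cond_expectation_unique mY _ _ _ hV (condV _ hM').
split=> //.
exact: (variance_mixed_poisson _ _ _ P _ _ N1 Y).
Qed.
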